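(* Let $k=2$ and $2\leq d\leq 4$ (i.e., $d=2,3$ or $4$). There exists no triangle which is a $T_2(2,b,d)$, for any integer $b\geq 3$ with $d\leq b-1$. That is, there is no triangle which is a $T_2(2,b,2)$, a $T_2(2,b,3)$, or a $T_2(2,b,4)$.
   Context: A Pythagorean triangle is a right triangle all of whose side lengths are positive integers. For integers $b\geq 3$, $2\leq d\leq b-1$ and $k\geq 2$, $d_{k,b}=d\,(b^{k-1}+\cdots+b+1)=\dfrac{d(b^k-1)}{b-1}$ denotes the positive integer whose base $b$ representation consists of $k$ digits all equal to $d$; in particular $d_{2,b}=d(b+1)$. A Pythagorean triangle is a Type 2 triangle with base $b$ repeated digits, denoted $T_2(k,b,d)$ (with $b\geq 3$, $2\leq d\leq b-1$, $k\geq 2$), if one of its legs has length $d^k$ and the other leg has length $d_{k,b}$. *)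

(* Defs.v *)
From mathcomp Require Import all_boot.

Set Implicit Arguments.
Unset Strict Implicit.
Unset Printing Implicit Defensive.

(* A right triangle with positive integer sides is given by its side lengths;
   the right angle, between the two legs, is expressed by Pythagoras' relation. *)
Record pythagorean_triangle := PythagoreanTriangle {
  leg1 : nat;
  leg2 : nat;
  hypotenuse : nat;
  leg1_gt0 : 0 < leg1;
  leg2_gt0 : 0 < leg2;
  hypotenuse_gt0 : 0 < hypotenuse;
  pythagoras : leg1 ^ 2 + leg2 ^ 2 = hypotenuse ^ 2
}.

(* The number d_{k,b} = d (b^(k-1) + ... + b + 1), written in base b with
   k digits all equal to d (for 0 < d < b). *)
Definition repdigit (k b d : nat) : nat := d * \sum_(i < k) b ^ i.

(* T_2(k,b,d): the legs of a triangle are unordered, hence the disjunction. *)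
Definition is_T2 (k b d : nat) (T : pythagorean_triangle) : Prop :=
  [/\ 3 <= b, 2 <= d <= b - 1, 2 <= k &
      (leg1 T = d ^ k /\ leg2 T = repdigit k b d) \/
      (leg1 T = repdigit k b d /\ leg2 T = d ^ k)].

(* Main.v *)
Require Import Defs.
From mathcomp Require Import all_boot.
From mathcomp Require Import zify.

(** Both legs [d ^ 2] and [d * (b + 1)] are multiples of [d], so the triangle is
    [d] times a Pythagorean triangle with legs [d] and [m = b + 1].  The
    constraint [d <= b - 1] makes [m >= d + 2], and for [d <= 4] this forces
    [d ^ 2 < 4 * m + 4 = (m + 2) ^ 2 - m ^ 2].  Hence the only square that
    [d ^ 2 + m ^ 2] could be is [(m + 1) ^ 2], that is [d ^ 2 = 2 * m + 1]
    ([short_leg_sq]).  But then [d] is odd, so [d = 3] and [m = 4 < d + 2]: the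
    triangle [(3, 4, 5)] is ruled out by [d <= b - 1] alone. *)

Lemma repdigit2 (b d : nat) : repdigit 2 b d = d * b.+1.
Proof. by rewrite /repdigit !big_ord_recr big_ord0 /= expn0 expn1 add0n add1n. Qed.

(** [d ^ 2] divides [z ^ 2], so [d] divides [z], and the common factor [d ^ 2]
    cancels. *)
Lemma pythagoras_descale (d x y z : nat) : 0 < d ->
  (d * x) ^ 2 + (d * y) ^ 2 = z ^ 2 -> exists e, x ^ 2 + y ^ 2 = e ^ 2.
Proof.
move=> d_gt0; rewrite !expnMn -mulnDr => def_z.
have /dvdnP[e def_e]: d %| z by rewrite -(@dvdn_pexp2r d z 2) // -def_z dvdn_mulr.
exists e; move/eqP: def_z.
by rewrite def_e expnMn mulnC eqn_pmul2r ?expn_gt0 ?d_gt0 // => /eqP.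
Qed.

(** A leg too short to reach from [m ^ 2] to [(m + 2) ^ 2] leaves [m + 1] as
    the only possible hypotenuse. *)
Lemma short_leg_sq (d m e : nat) : 0 < d -> d ^ 2 < 4 * m + 4 ->
  d ^ 2 + m ^ 2 = e ^ 2 -> d ^ 2 = 2 * m + 1.
Proof.
move=> d_gt0 d_small def_e.
have m_lt_e: m < e by rewrite -(@ltn_sqr m e) -def_e -[ltnLHS]add0n ltn_add2r expn_gt0 d_gt0.
have e_lt_m2: e < m.+2 by rewrite -(@ltn_sqr e m.+2) -def_e; nia.
have e_m1: e = m.+1 by lia.
by rewrite e_m1 in def_e; nia.
Qed.

Lemma no_short_leg_triangle (d m e : nat) : 2 <= d <= 4 -> d + 2 <= m ->
  d ^ 2 + m ^ 2 <> e ^ 2.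
Proof.
move=> d_range le_d2m def_e.
have: d ^ 2 = 2 * m + 1 by apply: short_leg_sq def_e; nia.
by case: d d_range le_d2m {def_e} => [|[|[|[|[|d]]]]] //; lia.
Qed.

Theorem theorem5 (b d : nat) (hb : 3 <= b) (hd : 2 <= d <= 4)
    (hdb : d <= b - 1) :
  ~ exists T : pythagorean_triangle, is_T2 2 b d T.
Proof.
move=> [T [_ _ _ legsT]].
have: (d * d) ^ 2 + (d * b.+1) ^ 2 = hypotenuse T ^ 2.
  rewrite -pythagoras mulnn.
  by case: legsT => [[-> ->] | [-> ->]]; rewrite repdigit2 // addnC.
case/pythagoras_descale => [|e]; first by lia.
by apply: no_short_leg_triangle hd _; lia.
Qed.
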